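(* Let $\rho=\mathcal N(0,\sigma^2)$ be a mean-zero Gaussian noise distribution and let $\mathbf A$ (depending on $\sigma$) be the corresponding moment matrix, such that $\overline{\mathbf G}=\mathbf G^\star\mathbf A$. Let $p$ be the maximum polynomial degree appearing in the true model and let $S^\star:=\mathrm{supp}(\mathbf w^\star)$. Consider the condition on a threshold $\widehat\lambda$: $$\min_{j\in S^\star}\left|\left(\mathbf A^{-1}\mathbf w^\star\right)_j\right|>\widehat\lambda>\max_{j\in(S^\star)^c}\left|\left(\mathbf A^{-1}\mathbf w^\star\right)_j\right|.\qquad( * )$$ Then: (i) If $p\le 2$ and the true coefficient of $u^2$ is zero, then there exists $\widehat\lambda$ satisfying $( * )$ for any finite noise level $\sigma>0$. (ii) If $p\ge3$, or if $p=2$ and the true coefficient of $u^2$ is nonzero, then there exists a critical noise level $\sigma_c$ satisfying $$\left(\frac{1}{2\binom p2 e}\right)\frac{\min_{j\in S^\star}|\mathbf w^\star_j|}{\max_{j\in S^\star}|\mathbf w^\star_j|}\le\sigma_c^2\le\frac1{\binom p2}$$ such that for all $\sigma<\sigma_c$ there exists $\widehat\lambda$ such that $( * )$ holds.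
   Context: Scalar setting: $u:D=\Omega\times(0,T)\to\mathbb R$ is a weak solution of $\partial^{\alpha^0}u=\sum_{s=1}^S\sum_{j=1}^J\mathbf w^\star_{(s-1)J+j}\,\partial^{\alpha^s}f_j(u)$, where $\alpha^0,\dots,\alpha^S$ are multi-indices of partial derivatives and the trial functions $(f_j)_{j=1}^J$ are the monomials $1,u,\dots,u^{p_{\max}}$ together with finitely many Fourier modes $e^{i\omega u}$, $\omega\in\boldsymbol\omega\subset\mathbb R$. A ''true model term'' is a library term $\partial^{\alpha^s}f_j(u)$ with nonzero coefficient in $\mathbf w^\star$; $p$ is the largest degree of a monomial $f_j$ appearing in a true model term. ''The coefficient of $u^2$'' means the coefficient of the undifferentiated term $u^2$ (multi-index $\alpha^s=0$). Library terms that vanish identically, i.e. $\partial^{\alpha^s}1$ with $\alpha^s\ne0$, are not part of the library (the noise-free matrix $\mathbf G^\star$ is assumed of full column rank). With a test function $\psi$ and query points $(\mathbf x_k,t_k)$, $k=1,\dots,K$, the noise-free matrix is $\mathbf G^\star_{k,(s-1)J+j}=(\partial^{\alpha^s}\psi*f_j(u))(\mathbf x_k,t_k)$ and the continuum (noisy) matrix is $\overline{\mathbf G}_{k,(s-1)J+j}=(\partial^{\alpha^s}\psi*(f_j\star\rho)(u))(\mathbf x_k,t_k)$, where $(f\star\rho)(y)=\int f(y+z)\,d\rho(z)$. Moment matrix: $\mathbf A$ is block diagonal with one block for each $s=1,\dots,S$, each block being $\mathrm{blkdiag}(\mathbf A^{(p_{\max})},\mathbf D^{\boldsymbol\omega})$,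 where $\mathbf D^{\boldsymbol\omega}=\mathrm{diag}(e^{-\sigma^2\omega^2/2})_{\omega\in\boldsymbol\omega}$ and, for $0\le i,j\le p_{\max}$, $\mathbf A^{(p_{\max})}_{i,j}=\binom ji(j-i-1)!!\,\sigma^{j-i}$ if $j\ge i$ and $j-i$ is even, and $0$ otherwise (with $(-1)!!=0!!=1$); rows and columns corresponding to omitted (identically zero) library terms are removed. *)

(* Defs.v *)
From HB Require Import structures.
From mathcomp Require Import all_boot all_order all_algebra.
From mathcomp Require Import all_classical all_reals all_analysis.
From mathcomp Require Import complex.

Set Implicit Arguments.
Unset Strict Implicit.
Unset Printing Implicit Defensive.

Import Order.TTheory GRing.Theory Num.Theory.
Import numFieldNormedType.Exports.

Local Open Scope classical_set_scope.
Local Open Scope ring_scope.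

(* The library has no measurable structure on ['rV[R]_n], but it has the
   product sigma-algebra on tuples. Lebesgue measure is built there by
   recursion on the dimension, as the image of the binary product measure;
   functions and sets on ['rV[R]_n] are pulled back along [rv_of_tuple]. *)
Section lebesgue_n.
Context {R : realType}.
Local Notation mR := (measurableTypeR R).

Definition tuple_cons n (p : mR * n.-tuple mR) : n.+1.-tuple mR :=
  [the n.+1.-tuple mR of p.1 :: p.2].

Lemma measurable_tuple_cons n : measurable_fun setT (@tuple_cons n).
Proof. exact: measurable_cons. Qed.

Lemma measurable_tuple_uncons n :
  measurable_fun setT
    (fun t : n.+1.-tuple mR => (thead t, [tuple of behead t])).
Proof.
apply/measurable_fun_pairP; split => /=; last exact: measurable_behead.
exact: measurable_tnth.
Qed.

Section step.
Variables (n : nat) (m : {sigma_finite_measure set (n.-tuple mR) -> \bar R}).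

Definition lebesgue_step : set (n.+1.-tuple mR) -> \bar R :=
  pushforward (lebesgue_measure \x m)%E (@tuple_cons n).

Let step0 : lebesgue_step set0 = 0%E.
Proof. by rewrite /lebesgue_step /pushforward preimage_set0 measure0. Qed.

Let step_ge0 A : (0 <= lebesgue_step A)%E.
Proof. by rewrite /lebesgue_step /pushforward; exact: measure_ge0. Qed.

Let step_sigma_additive : semi_sigma_additive lebesgue_step.
Proof.
move=> F mF tF mUF; rewrite /lebesgue_step /pushforward preimage_bigcup.
have mp A : measurable A -> measurable (@tuple_cons n @^-1` A).
  by move=> mA; rewrite -[X in measurable X]setTI; exact: measurable_tuple_cons.
apply: measure_semi_sigma_additive.
- by move=> k; exact: mp.
- apply/trivIsetP => /= i j _ _ ij; rewrite -preimage_setI.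
  by move/trivIsetP : tF => /(_ _ _ _ _ ij) ->//; rewrite preimage_set0.
- by rewrite -preimage_bigcup; exact: mp.
Qed.

HB.instance Definition _ := isMeasure.Build _ _ _ lebesgue_step
  step0 step_ge0 step_sigma_additive.

Let step_sigma_finite : sigma_finite setT lebesgue_step.
Proof.
have /sigma_finiteP[F [TF ndF Foo]] :=
  sigma_finiteT (@lebesgue_measure R : {sigma_finite_measure set mR -> \bar R}).
have /sigma_finiteP[G [TG ndG Goo]] := sigma_finiteT m.
pose g (t : n.+1.-tuple mR) := (thead t, [tuple of behead t]).
have gK p : g (tuple_cons p) = p.
  by case: p => x t; rewrite /g /tuple_cons /= theadE; congr pair; exact/val_inj.
exists (fun k => g @^-1` (F k `*` G k)).
  rewrite -preimage_bigcup (_ : \bigcup_k _ = setT) ?preimage_setT//.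
  rewrite -setXTT TF TG predeqE => -[x y]; split.
    by move=> [k _ []/= ? ?]; split; exists k.
  move=> [/= [i _ Fix] [k _ Gky]]; exists (maxn i k) => //; split.
  - by move: x Fix; exact/subsetPset/ndF/leq_maxl.
  - by move: y Gky; exact/subsetPset/ndG/leq_maxr.
move=> k; have [mF Fk] := Foo k; have [mG Gk] := Goo k; split.
  rewrite -[X in measurable X]setTI; apply: measurable_tuple_uncons => //.
  exact: measurableX.
rewrite /lebesgue_step /pushforward -comp_preimage.
rewrite (_ : g \o _ = id); last by apply/funext => p; exact: gK.
by rewrite preimage_id product_measure1E// lte_mul_pinfty// ge0_fin_numE.
Qed.

HB.instance Definition _ := Measure_isSigmaFinite.Build _ _ _ lebesgue_step
  step_sigma_finite.

End step.

Fixpoint lebesgue_n n : {sigma_finite_measure set (n.-tuple mR) -> \bar R} :=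
  if n is k.+1 then lebesgue_step (lebesgue_n k) else \d_([tuple] : 0.-tuple mR).

Definition rv_of_tuple n (t : n.-tuple mR) : 'rV[R]_n := \row_i tnth t i.

Definition integral_n n (D : set 'rV[R]_n) (f : 'rV[R]_n -> R) : R :=
  \int[lebesgue_n n]_(t in @rv_of_tuple n @^-1` D) f (rv_of_tuple t).

Definition locally_integrable_n n (D : set 'rV[R]_n) (f : 'rV[R]_n -> R) :=
  forall K, compact K -> K `<=` D ->
    (lebesgue_n n).-integrable (@rv_of_tuple n @^-1` K)
      (fun t => (f (rv_of_tuple t))%:E).

Definition cintegral_n n (D : set 'rV[R]_n) (f : 'rV[R]_n -> R[i]) : R[i] :=
  Complex (integral_n D (fun y => complex.Re (f y)))
          (integral_n D (fun y => complex.Im (f y))).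

Definition clocally_integrable_n n (D : set 'rV[R]_n) (f : 'rV[R]_n -> R[i]) :=
  locally_integrable_n D (fun y => complex.Re (f y)) /\
  locally_integrable_n D (fun y => complex.Im (f y)).

End lebesgue_n.

Section derivatives.
Context {R : realType}.

Definition multi_index n := {ffun 'I_n -> nat}.

Definition mi0 n : multi_index n := [ffun=> 0%N].

Definition mi_order n (a : multi_index n) : nat := \sum_i a i.

(* [iter_partial [:: i1; ...; ik] f] is d/dx_i1 ... d/dx_ik f. *)
Definition iter_partial n (s : seq 'I_n) (f : 'rV[R]_n -> R) : 'rV[R]_n -> R :=
  foldr (fun i (g : 'rV[R]_n -> R) x => 'D_(delta_mx 0 i) g x) f s.

Definition partial n (a : multi_index n) (f : 'rV[R]_n -> R) : 'rV[R]_n -> R :=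
  iter_partial (flatten [seq nseq (a i) i | i <- enum 'I_n]) f.

Definition class_C n (k : nat) (f : 'rV[R]_n -> R) :=
  (forall s : seq 'I_n, (size s <= k)%N -> continuous (iter_partial s f)) /\
  (forall (s : seq 'I_n) i x, (size s < k)%N ->
    derivable (iter_partial s f) x (delta_mx 0 i)).

Definition fsupp n (f : 'rV[R]_n -> R) : set 'rV[R]_n :=
  closure [set x | f x != 0].

Definition test_function n (D : set 'rV[R]_n) (phi : 'rV[R]_n -> R) :=
  [/\ forall k, class_C k phi, compact (fsupp phi) & fsupp phi `<=` D].

(* Omega x (0, T), the last coordinate being time. *)
Definition space_time d (Omega : set 'rV[R]_d) (T : R) : set 'rV[R]_(d + 1) :=
  [set y | Omega (lsubmx y) /\ 0 < rsubmx y 0 0 < T].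

End derivatives.

Section library.
Context {R : realType}.
Variables (n S pmax q : nat).
Variables (alpha : 'I_S -> multi_index n) (omega : 'I_q -> R).

(* The trial functions are numbered by ['I_(pmax.+1 + q)]: first the monomials
   1, u, ..., u^pmax, then the Fourier modes exp(i omega_r u). *)
Definition trial (j : 'I_(pmax.+1 + q)) (y : R) : R[i] :=
  match fintype.split j with
  | inl m => Complex (y ^+ m) 0
  | inr r => Complex (cos (omega r * y)) (sin (omega r * y))
  end.

(* [(s, j)] stands for the term d^(alpha s) f_j(u); the terms d^a 1, a != 0,
   are left out. *)
Definition library : {set 'I_S * 'I_(pmax.+1 + q)} :=
  [set x | (alpha x.1 == mi0 n) || (fintype.split x.2 != inl ord0)].

(* Columns of the matrices below are numbered by ['I_#|library|]. *)
Definition term (l : 'I_#|library|) : 'I_S * 'I_(pmax.+1 + q) := enum_val l.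

Definition mi_of (l : 'I_#|library|) : multi_index n := alpha (term l).1.

Definition trial_of (l : 'I_#|library|) : R -> R[i] := trial (term l).2.

(* Degree of the monomial of a term; Fourier modes do not count. *)
Definition mono_degree (l : 'I_#|library|) : nat :=
  if fintype.split (term l).2 is inl m then m else 0%N.

Definition is_monomial (a : multi_index n) (k : nat) (l : 'I_#|library|) : bool :=
  (mi_of l == a) && (if fintype.split (term l).2 is inl m then m == k :> nat else false).

Definition supp (w : 'cV[R[i]]_#|library|) : {set 'I_#|library|} :=
  [set l | w l 0 != 0].

Definition model_degree (w : 'cV[R[i]]_#|library|) : nat :=
  \max_(l in supp w) mono_degree l.

(* Coefficient of d^a u^k, 0 if this term is not in the library. There is at
   most one summand when the multi-indices are distinct. *)
Definition mono_coef (w : 'cV[R[i]]_#|library|) a k : R[i] :=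
  \sum_(l | is_monomial a k l) w l 0.

Fixpoint double_fact (k : nat) : nat :=
  if k is k'.+2 then (k * double_fact k')%N else 1%N.

(* [(j - i).-1] is j - i - 1 for i < j, and 0 for i = j, which agrees with
   the convention (-1)!! = 0!! = 1. *)
Definition poly_moment_mx (sigma : R) : 'M[R]_pmax.+1 :=
  \matrix_(i, j) if (i <= j)%N && ~~ odd (j - i)
    then 'C(j, i)%:R * (double_fact (j - i).-1)%:R * sigma ^+ (j - i) else 0.

Definition fourier_moment_mx (sigma : R) : 'M[R]_q :=
  diag_mx (\row_r expR (- (sigma ^+ 2 * omega r ^+ 2 / 2))).

Definition moment_block (sigma : R) : 'M[R]_(pmax.+1 + q) :=
  block_mx (poly_moment_mx sigma) 0 0 (fourier_moment_mx sigma).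

Definition moment_mx (sigma : R) : 'M[R[i]]_#|library| :=
  \matrix_(k, l) Complex
    (if (term k).1 == (term l).1
     then moment_block sigma (term k).2 (term l).2 else 0) 0.

(* [mi_order] accounts for the integrations by parts. *)
Definition weak_solution (D : set 'rV[R]_n) (alpha0 : multi_index n)
    (w : 'cV[R[i]]_#|library|) (u : 'rV[R]_n -> R) :=
  [/\ locally_integrable_n D u,
      forall j, clocally_integrable_n D (fun y => trial j (u y)) &
      forall phi, test_function D phi ->
        (-1) ^+ mi_order alpha0 *
          cintegral_n D (fun y => Complex (partial alpha0 phi y * u y) 0) =
        \sum_l w l 0 * ((-1) ^+ mi_order (mi_of l) *
          cintegral_n D (fun y =>
            Complex (partial (mi_of l) phi y) 0 * trial_of l (u y)))].

(* (d^a psi * g)(x), g being defined on D only. *)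
Definition convolve (D : set 'rV[R]_n) (k : 'rV[R]_n -> R)
    (g : 'rV[R]_n -> R[i]) (x : 'rV[R]_n) : R[i] :=
  cintegral_n D (fun y => Complex (k (x - y)) 0 * g y).

(* (f * rho)(y) = int f(y + z) d rho(z) *)
Definition noise_average (rho : set (measurableTypeR R) -> \bar R)
    (f : R -> R[i]) (y : R) : R[i] :=
  Complex (fine (\int[rho]_z (complex.Re (f (y + z)))%:E))
          (fine (\int[rho]_z (complex.Im (f (y + z)))%:E)).

Definition noise_free_mx (D : set 'rV[R]_n) (psi u : 'rV[R]_n -> R)
    K (pts : 'I_K -> 'rV[R]_n) : 'M[R[i]]_(K, #|library|) :=
  \matrix_(k, l)
    convolve D (partial (mi_of l) psi) (fun y => trial_of l (u y)) (pts k).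

Definition continuum_mx (D : set 'rV[R]_n) (psi u : 'rV[R]_n -> R)
    (rho : set (measurableTypeR R) -> \bar R)
    K (pts : 'I_K -> 'rV[R]_n) : 'M[R[i]]_(K, #|library|) :=
  \matrix_(k, l)
    convolve D (partial (mi_of l) psi)
      (fun y => noise_average rho (trial_of l) (u y)) (pts k).

End library.

Section threshold.
Context {R : realType}.
Variable m : nat.

(* Over the empty set, the minimum is +oo and the maximum is 0. *)
Definition min_abs (I : {set 'I_m}) (v : 'cV[R[i]]_m) : \bar R :=
  \big[Order.min/+oo%E]_(j in I) (Normc.normc (v j 0))%:E.

Definition max_abs (I : {set 'I_m}) (v : 'cV[R[i]]_m) : \bar R :=
  \big[Order.max/0%E]_(j in I) (Normc.normc (v j 0))%:E.

Definition separates (A : 'M[R[i]]_m) (I : {set 'I_m}) (w : 'cV[R[i]]_m)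
    (lambda : R) :=
  (lambda%:E < min_abs I (invmx A *m w))%E /\
  (max_abs (~: I) (invmx A *m w) < lambda%:E)%E.

End threshold.

(* Main.v *)
(* On polynomials, averaging against N(0, sigma^2) is exp(sigma^2/2 D^2), so
   A^-1 is given blockwise by exp(-sigma^2/2 D^2) on the monomials and by the
   factors exp(sigma^2 omega^2/2) >= 1 on the Fourier modes. Only the monomial
   blocks can blur the support, and there the (i, i + 2a) entry of A^-1 is, for
   i + 2a <= p, at most (C sigma^2)^a / a! in absolute value, C = binom(p, 2). For
   C sigma^2 <= 1 the error |A^-1 w - w| is therefore below
   C sigma^2 e max|w|, and half of min|w| separates as soon as this is less
   than min|w| / 2. In case (i) the only possible off-diagonal entry, from u^2
   to 1, meets a zero coefficient, so A^-1 w = w on the monomials. *)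
Require Import Defs.
From HB Require Import structures.
From mathcomp Require Import all_boot all_order all_algebra.
From mathcomp Require Import all_classical all_reals all_analysis.
From mathcomp Require Import complex.
From mathcomp Require Import ring lra zify.

Set Implicit Arguments.
Unset Strict Implicit.
Unset Printing Implicit Defensive.

Import Order.TTheory GRing.Theory Num.Theory.
Import numFieldNormedType.Exports.

Local Open Scope classical_set_scope.
Local Open Scope ring_scope.

(** * Factorials and sums over one parity class *)

Lemma double_fact_even n : (double_fact n.*2.-1 * (2 ^ n * n`!) = n.*2`!)%N.
Proof.
elim: n => // -[//|n] IHn.
have dfE : double_fact n.+2.*2.-1 = (n.+1.*2.+1 * double_fact n.+1.*2.-1)%N by [].
rewrite dfE expnS (factS n.+1) (doubleS n.+1) (factS n.+1.*2.+1) (factS n.+1.*2).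
rewrite -IHn -mul2n; ring.
Qed.

(** Turns a sum along a matrix row into a sum over powers of [D^2]: each [k] that can contribute is
    [i + a.*2] for exactly one [a], namely half of [k - i]. *)
Lemma sum_even_shift (V : nmodType) (F : nat -> V) (i N : nat) :
  (forall k, ~~ ((i <= k)%N && ~~ odd (k - i)) -> F k = 0) ->
  \sum_(k < N) F k = \sum_(a < N | (i + a.*2 < N)%N) F (i + a.*2)%N.
Proof.
move=> F0; transitivity
    (\sum_(k < N) \sum_(a < N | (i + a.*2 < N)%N && (i + a.*2 == k)%N) F k).
  apply: eq_bigr => -[k kN] _ /=.
  have [kP|/F0 ->] := boolP ((i <= k)%N && ~~ odd (k - i)); last by rewrite big1.
  have kE : (i + (k - i)./2.*2)%N = k by lia.
  have aN : ((k - i)./2 < N)%N by lia.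
  rewrite (big_pred1 (Ordinal aN)) // => -[a ?]; rewrite /= -val_eqE /=; lia.
rewrite (exchange_big_dep (fun a : 'I_N => (i + a.*2 < N)%N)) /=; last first.
  by move=> k a _ /andP[].
apply: eq_bigr => a aN; rewrite (big_pred1 (Ordinal aN)) //= => k.
by rewrite aN /= -val_eqE /= eq_sym.
Qed.

(** * The one-parameter semigroup exp(c D^2) on monomials *)

Section heat_coef.
Context {R : numFieldType}.
Implicit Types (c d : R) (i j : nat).

(* The coefficient of X^i in exp(c D^2) X^j, where D is the derivation. *)
Definition heat_coef c i j : R :=
  if (i <= j)%N && ~~ odd (j - i)
  then j`!%:R / (i`!%:R * (j - i)./2`!%:R) * c ^+ (j - i)./2 else 0.

Lemma heat_coef_out c i j :
  ~~ ((i <= j)%N && ~~ odd (j - i)) -> heat_coef c i j = 0.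
Proof. by rewrite /heat_coef => /negbTE ->. Qed.

Lemma heat_coef_even c i a :
  heat_coef c i (i + a.*2) = (i + a.*2)`!%:R / (i`!%:R * a`!%:R) * c ^+ a.
Proof. by rewrite /heat_coef leq_addr addKn odd_double doubleK. Qed.

Lemma heat_coef_id c i : heat_coef c i i = 1.
Proof.
by rewrite /heat_coef leqnn subnn /= expr0 !mulr1 divff // pnatr_eq0 -lt0n
  fact_gt0.
Qed.

Lemma heat_coef_neq0 c i j :
  heat_coef c i j != 0 -> exists n, j = (i + n.*2)%N.
Proof.
have [/andP[ij ej] _|/heat_coef_out->] := boolP ((i <= j)%N && ~~ odd (j - i)).
  by exists (j - i)./2; rewrite halfK (negbTE ej) subn0 subnKC.
by rewrite eqxx.
Qed.

Lemma heat_coef0 i j : heat_coef 0 i j = (i == j)%:R.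
Proof.
have [->|ij] := eqVneq i j; first exact: heat_coef_id.
apply/eqP; apply: contraT => /[dup] /heat_coef_neq0[[|n] jE].
  by move: ij; rewrite jE addn0 eqxx.
by rewrite jE heat_coef_even expr0n mulr0 eqxx.
Qed.

(** Semigroup law of exp(c D^2). For [j = i + n.*2] the a-th surviving product is j!/(i! n!) times
    the a-th term in the binomial expansion of (d + c)^n. Cutting the sum at [N > j] loses nothing,
    since D^2 only lowers degrees. *)
Lemma heat_coefD c d i j N : (j < N)%N ->
  \sum_(k < N) heat_coef c i k * heat_coef d k j = heat_coef (c + d) i j.
Proof.
move=> jN; have [ij|nij] := boolP ((i <= j)%N && ~~ odd (j - i)); last first.
  rewrite (heat_coef_out _ nij) big1 // => k _.
  have [ik|/heat_coef_out ->] := boolP ((i <= k)%N && ~~ odd (k - i)).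
    by rewrite (heat_coef_out d) ?mulr0 //; lia.
  by rewrite mul0r.
have [n jE] : exists n, j = (i + n.*2)%N.
  by exists (j - i)./2; rewrite halfK; lia.
rewrite (sum_even_shift (i := i) (F := fun k => heat_coef c i k * heat_coef d k j));
  last by move=> k /heat_coef_out ->; rewrite mul0r.
transitivity (\sum_(a < n.+1)
    j`!%:R / (i`!%:R * n`!%:R) * (d ^+ (n - a) * c ^+ a *+ 'C(n, a))).
  have nN : (n.+1 <= N)%N by lia.
  rewrite (big_ord_widen N (fun a => j`!%:R / (i`!%:R * n`!%:R) *
    (d ^+ (n - a) * c ^+ a *+ 'C(n, a))) nN).
  rewrite [LHS](bigID (fun a : 'I_N => (a < n.+1)%N)) /= [X in _ + X]big1 ?addr0.
    apply: eq_big => [a|a /andP[_ an]]; first by lia.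
    have -> : j = (i + a.*2 + (n - a).*2)%N by lia.
    have nfE : n`!%:R = 'C(n, a)%:R * (a`!%:R * (n - a)`!%:R) :> R.
      by rewrite -!natrM bin_fact.
    rewrite !heat_coef_even nfE -mulr_natr.
    have f0 x : x`!%:R != 0 :> R by rewrite pnatr_eq0 -lt0n fact_gt0.
    have b0 : 'C(n, a)%:R != 0 :> R by rewrite pnatr_eq0 -lt0n bin_gt0.
    by field; rewrite ?f0 ?b0.
  (* For a > n the intermediate degree [i + a.*2] already exceeds [j]. *)
  move=> a /andP[_ an]; rewrite [X in _ * X]heat_coef_out ?mulr0 //; lia.
by rewrite -mulr_sumr -exprDn [d + c]addrC jE heat_coef_even.
Qed.

End heat_coef.

(** * Size of the entries and row sums of exp(-sigma^2/2 D^2) *)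

(** The quotient of the factorials is a product of [a] pairs of consecutive integers at most [p],
    and each pair contributes at most p (p - 1). *)
Lemma fact_shift_le i a p : (i + a.*2 <= p)%N ->
  ((i + a.*2)`! <= i`! * (p * p.-1) ^ a)%N.
Proof.
elim: a => [|a IHa] ap; first by rewrite addn0 muln1.
rewrite doubleS !addnS (factS (i + a.*2).+1) (factS (i + a.*2)) mulnA expnS.
rewrite [leqRHS]mulnCA; apply: leq_mul; last by apply: IHa; lia.
by apply: leq_mul; lia.
Qed.

Lemma sum_le_expR (R : realType) (x : R) n : 0 <= x ->
  \sum_(k < n) x ^+ k / k`!%:R <= expR x.
Proof.
move=> x0; have := @nondecreasing_cvgn_le R (series (exp_coeff x)) _ _ n.
rewrite /series /= big_mkord /exp_coeff /=; apply.
  by apply: nondecreasing_series => k _ _; exact: exp_coeff_ge0.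
exact: is_cvg_series_exp_coeff.
Qed.

(** One factor [x] comes out of every term; what is left, x^k/(k+1)!, is at most 1/k!, a term of the
    series of e. *)
Lemma sum_expR_tail_le (R : realType) (x : R) n : 0 <= x <= 1 ->
  \sum_(k < n | (0 < k)%N) x ^+ k / k`!%:R <= x * expR 1.
Proof.
case/andP => x0 x1; case: n => [|n]; first by rewrite big_ord0 mulr_ge0 ?expR_ge0.
rewrite big_mkcond big_ord_recl /= add0r.
apply: (le_trans (y := x * \sum_(k < n) 1 ^+ k / k`!%:R)); last first.
  by rewrite ler_wpM2l // sum_le_expR.
rewrite mulr_sumr ler_sum // => k _; rewrite /bump /= add1n exprS expr1n -mulrA.
rewrite ler_wpM2l // ler_pM ?exprn_ge0 ?exprn_ile1 //.
by rewrite lef_pV2 ?posrE ?ltr0n ?fact_gt0 // ler_nat leq_fact.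
Qed.

(** Since p (p - 1) = 2 binom(p, 2), the a-th power of 2 from the factorial quotient cancels the one
    in (sigma^2/2)^a. *)
Lemma heat_coef_norm_le (R : realType) (sigma : R) i a p : (i + a.*2 <= p)%N ->
  `|heat_coef (- (sigma ^+ 2 / 2)) i (i + a.*2)| <=
  ('C(p, 2)%:R * sigma ^+ 2) ^+ a / a`!%:R.
Proof.
move=> ap; have f0 x : 0 < x`!%:R :> R by rewrite ltr0n fact_gt0.
have Cp : 'C(p, 2)%:R = (p * p.-1)%:R / 2 :> R.
  have -> : (p * p.-1 = 'C(p, 2) * 2)%N by rewrite bin_ffact ffactnS ffactn1.
  by rewrite natrM mulfK ?pnatr_eq0.
have s0 : 0 <= (sigma ^+ 2 / 2) ^+ a by rewrite exprn_ge0 // divr_ge0 ?sqr_ge0.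
rewrite heat_coef_even normrM normrX normrN.
rewrite ger0_norm; last by rewrite divr_ge0 ?mulr_ge0 // ltW.
rewrite ger0_norm ?divr_ge0 ?sqr_ge0 // Cp.
have -> : (p * p.-1)%:R / 2 * sigma ^+ 2 = (p * p.-1)%:R * (sigma ^+ 2 / 2) by field.
rewrite [in leRHS]exprMn [leRHS]mulrAC ler_wpM2r // ler_pdivrMr ?mulr_gt0 //.
have -> : (p * p.-1)%:R ^+ a / a`!%:R * (i`!%:R * a`!%:R)
          = i`!%:R * (p * p.-1)%:R ^+ a :> R.
  by field; rewrite gt_eqF.
by rewrite -natrX -natrM ler_nat fact_shift_le.
Qed.

Lemma heat_coef_row_le (R : realType) (sigma : R) i p N :
  'C(p, 2)%:R * sigma ^+ 2 <= 1 ->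
  \sum_(j < N | (i < j <= p)%N) `|heat_coef (- (sigma ^+ 2 / 2)) i j| <=
  'C(p, 2)%:R * sigma ^+ 2 * expR 1.
Proof.
move=> x1; set x := _ * sigma ^+ 2 in x1 *.
have x0 : 0 <= x by rewrite mulr_ge0 ?sqr_ge0.
(* The range condition goes into the summand, so that the parity reindexing applies; [i < j] then
   becomes [0 < a], which drops the diagonal term. *)
pose F j := if (i < j <= p)%N then `|heat_coef (- (sigma ^+ 2 / 2)) i j| else 0.
rewrite big_mkcond (sum_even_shift (i := i) (F := F)); last first.
  by move=> k /heat_coef_out kE; rewrite /F kE normr0 if_same.
apply: le_trans (sum_expR_tail_le N _); last by rewrite x0.
rewrite big_mkcond [leRHS]big_mkcond ler_sum // => a _; rewrite /F.
have t0 : 0 <= x ^+ a / a`!%:R by rewrite divr_ge0 ?exprn_ge0.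
case: ifP => _; last by case: ifP.
case: ifP => [/andP[ia ap]|_]; last by case: ifP.
have -> : (0 < a)%N by lia.
exact: heat_coef_norm_le.
Qed.

(** * The complex modulus *)

Section normc.
Context {R : realType}.

Lemma normc_sum (I : Type) (r : seq I) (P : pred I) (F : I -> R[i]) :
  Normc.normc (\sum_(x <- r | P x) F x) <= \sum_(x <- r | P x) Normc.normc (F x).
Proof.
elim/big_ind2: _ => [|x a y b xa yb|//]; first by rewrite Normc.normc0.
by rewrite (le_trans (le_normcD _ _)) // lerD.
Qed.

Lemma normc_real (x : R) : Normc.normc x%:C%C = `|x|.
Proof. by rewrite /Normc.normc /= expr0n addr0 sqrtr_sqr. Qed.

Lemma normc_ge0 (z : R[i]) : 0 <= Normc.normc z.
Proof. by case: z => a b; rewrite sqrtr_ge0. Qed.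

Lemma normc_gt0 (z : R[i]) : (z != 0) = (0 < Normc.normc z).
Proof.
rewrite lt0r normc_ge0 andbT; apply/idP/idP; apply: contra => /eqP.
  by move=> /Normc.eq0_normc ->.
by move=> ->; rewrite Normc.normc0.
Qed.

End normc.

(** * The inverse of the moment matrix and its action on coefficients *)

Section library_matrices.
Context {R : realType}.
Variables (n S pmax q : nat).
Variables (alpha : 'I_S -> multi_index n) (omega : 'I_q -> R).
Implicit Types (sigma : R) (M N : 'M[R]_(pmax.+1 + q)).

Local Notation lib := (library pmax q alpha).

(** The Gaussian moment (2m-1)!! sigma^(2m) equals (2m)!/m! (sigma^2/2)^m, and (2m)! times the
    binomial coefficient is (i+2m)!/i!. *)
Lemma poly_moment_mxE sigma :
  poly_moment_mx pmax sigma = \matrix_(i, j) heat_coef (sigma ^+ 2 / 2) i j.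
Proof.
apply/matrixP => i j; rewrite !mxE.
have [/andP[ij ej]|/heat_coef_out->//] := boolP ((i <= j)%N && ~~ odd (j - i)).
have [m jE] : exists m, nat_of_ord j = (i + m.*2)%N by exists (j - i)./2; lia.
rewrite jE heat_coef_even addKn.
have f0 x : x`!%:R != 0 :> R by rewrite pnatr_eq0 -lt0n fact_gt0.
have d0 : (double_fact m.*2.-1)%:R = m.*2`!%:R / (2 ^+ m * m`!%:R) :> R.
  by rewrite -double_fact_even !natrM natrX mulfK // mulf_neq0 // expf_neq0.
have -> : (i + m.*2)`!%:R = 'C(i + m.*2, i)%:R * (i`!%:R * m.*2`!%:R) :> R.
  by rewrite -!natrM -(@bin_fact (i + m.*2) i) ?leq_addr // addKn.
rewrite d0 expr_div_n -exprM mul2n.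
by field; rewrite !f0 expf_neq0.
Qed.

Definition inv_moment_block sigma : 'M[R]_(pmax.+1 + q) :=
  block_mx (\matrix_(i, j) heat_coef (- (sigma ^+ 2 / 2)) i j) 0
    0 (diag_mx (\row_r expR (sigma ^+ 2 * omega r ^+ 2 / 2))).

Lemma moment_blockK sigma :
  moment_block pmax omega sigma *m inv_moment_block sigma = 1%:M.
Proof.
rewrite mulmx_block !(mulmx0, mul0mx, addr0, add0r) scalar_mx_block.
congr block_mx; apply/matrixP => i j.
  rewrite poly_moment_mxE !mxE; under eq_bigr do rewrite !mxE.
  by rewrite heat_coefD // subrr heat_coef0.
by rewrite mulmx_diag !mxE; case: eqP => // ->; rewrite !mulr1n -expRD addNr expR0.
Qed.

Definition library_mx M : 'M[R[i]]_#|lib| :=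
  \matrix_(k, l) Complex
    (if (term k).1 == (term l).1 then M (term k).2 (term l).2 else 0) 0.

Lemma library_mx1 : library_mx 1%:M = 1%:M.
Proof.
apply/matrixP => k l; rewrite !mxE.
have -> : (k == l) = (term k == term l) by rewrite (inj_eq enum_val_inj).
case: (term k) (term l) => [s i] [t j]; rewrite xpair_eqE /=.
by case: (s == t); case: (i == j).
Qed.

(* A library lacking d^a 1 loses the row and column of the constant monomial;
   the hypothesis on M makes the lost column vanish on the remaining rows. *)
Lemma library_mxM M N :
  (forall i, i != lshift q ord0 -> M i (lshift q ord0) = 0) ->
  library_mx M *m library_mx N = library_mx (M *m N).
Proof.
move=> M0; apply/matrixP => k l; rewrite !mxE.
(* [G] extends the summand to all pairs, including the omitted terms, so that the sum can be split
   by multi-index. *)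
pose G (x : 'I_S * 'I_(pmax.+1 + q)) : R :=
  (if (term k).1 == x.1 then M (term k).2 x.2 else 0) *
  (if x.1 == (term l).1 then N x.2 (term l).2 else 0).
transitivity ((\sum_(x in lib) G x)%:C)%C.
  rewrite [in RHS]big_enum_val rmorph_sum; apply: eq_bigr => h _.
  by rewrite !mxE /G rmorphM.
congr Complex; rewrite big_mkcond /=.
transitivity (\sum_x G x).
  apply: eq_bigr => x _; case: ifPn => //.
  rewrite inE negb_or negbK => /andP[x0 /eqP x2].
  have xE : x.2 = lshift q ord0.
    by rewrite -(splitK x.2) x2.
  rewrite /G; case: eqP => [kx|]; rewrite ?mul0r // xE M0 ?mul0r //.
  (* Row [k] lies in the library and has the nonzero multi-index of the omitted [x], so its trial
     function is not the constant 1. *)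
  have := enum_valP k; rewrite -/(term k) inE kx (negbTE x0) /=.
  by apply: contra => /eqP ->; rewrite (unsplitK (inl ord0)).
rewrite -(pair_bigA _ (fun i j => G (i, j))) (bigD1 (term k).1) //=.
rewrite [X in _ + X]big1 ?addr0.
  case: eqP => [kl|/eqP/negbTE kl].
    by apply: eq_bigr => j _; rewrite /G /= -kl eqxx.
  by rewrite big1 // => j _; rewrite /G /= kl mulr0.
by move=> s sk; rewrite big1 // => j _; rewrite /G /= eq_sym (negbTE sk) mul0r.
Qed.

Lemma invmx_moment_mx sigma :
  invmx (moment_mx pmax alpha omega sigma) = library_mx (inv_moment_block sigma).
Proof.
have AB : moment_mx pmax alpha omega sigma *m
    library_mx (inv_moment_block sigma) = 1%:M.
  (* The first column of the moment block vanishes below the diagonal because averaging a monomial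
     produces no higher degrees and never mixes it with Fourier modes. *)
  rewrite -library_mx1 -(moment_blockK sigma) -library_mxM // => i.
  have := splitK i; case: fintype.split => [j|r] /= <- i0.
    rewrite block_mxEul poly_moment_mxE mxE heat_coef_out //.
    rewrite leqn0; apply: contra i0 => /andP[/eqP j0 _].
    by rewrite (_ : j = ord0) //; apply: val_inj.
  by rewrite block_mxEdl mxE.
have [Au _] := mulmx1_unit AB.
by rewrite -[LHS]mulmx1 -AB mulKmx.
Qed.

Local Notation denoise sigma w := (invmx (moment_mx pmax alpha omega sigma) *m w).

Lemma denoise_fourier sigma (w : 'cV[R[i]]_#|lib|) l r :
  (term l).2 = rshift pmax.+1 r ->
  denoise sigma w l 0 = (expR (sigma ^+ 2 * omega r ^+ 2 / 2))%:C%C * w l 0.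
Proof.
move=> lr; rewrite invmx_moment_mx mxE (bigD1 l) //= big1 ?addr0 => [|h hl].
  by rewrite mxE eqxx lr block_mxEdr !mxE eqxx mulr1n.
rewrite mxE; case: eqP => [lh|_]; last by rewrite mul0r.
have hE := splitK (term h).2; case: fintype.split hE => [j|t] /= hE.
  by rewrite lr -hE block_mxEdl mxE mul0r.
rewrite lr -hE block_mxEdr !mxE; case: eqP => [rt|_]; last by rewrite mulr0n mul0r.
case/eqP: hl; apply: enum_val_inj; rewrite -/(term h) -/(term l).
by rewrite [term h]surjective_pairing [term l]surjective_pairing lh lr rt hE.
Qed.

Lemma denoise_monomial sigma (w : 'cV[R[i]]_#|lib|) l (i : 'I_pmax.+1) :
  (term l).2 = lshift q i ->
  denoise sigma w l 0 - w l 0 =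
  \sum_(h | h != l) (library_mx (inv_moment_block sigma) l h) * w h 0.
Proof.
move=> li; rewrite invmx_moment_mx mxE (bigD1 l) //=.
by rewrite [X in X * _]mxE eqxx li block_mxEul mxE heat_coef_id mul1r addrAC subrr add0r.
Qed.

Lemma library_mx_inv_neq0 sigma l h (i : 'I_pmax.+1) :
  (term l).2 = lshift q i -> h != l ->
  library_mx (inv_moment_block sigma) l h != 0 ->
  exists j : 'I_pmax.+1, [/\ (term h).1 = (term l).1, (term h).2 = lshift q j,
    (i < j)%N, ~~ odd (j - i) & library_mx (inv_moment_block sigma) l h =
    (heat_coef (- (sigma ^+ 2 / 2)) i j)%:C%C].
Proof.
move=> li hl; rewrite mxE; have [lh|_] := eqVneq (term l).1 (term h).1; last first.
  by move=> /negP[]; apply/eqP.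
have hE := splitK (term h).2; case: fintype.split hE => [j|t] /= hE; last first.
  by rewrite li -hE block_mxEur mxE => /negP[]; apply/eqP.
rewrite li -hE block_mxEul mxE => b0.
have [k jE] : exists k, nat_of_ord j = (i + k.*2)%N.
  apply: (@heat_coef_neq0 _ (- (sigma ^+ 2 / 2))).
  by apply: contra b0 => /eqP ->; apply/eqP.
exists j; split => //; last by rewrite jE addKn odd_double.
case: k jE => [|k] jE; last by rewrite jE; lia.
case/eqP: hl; apply: enum_val_inj; rewrite -/(term h) -/(term l).
rewrite [term h]surjective_pairing [term l]surjective_pairing lh li -hE.
by congr (_, lshift _ _); apply: val_inj; rewrite /= jE addn0.
Qed.

(** Only terms with the multi-index of [l] and a monomial of larger degree interact with [l], and
    those of degree above [p] meet a zero coefficient. The error is thus controlled by one truncated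
    row of exp(-sigma^2/2 D^2). *)
Lemma denoise_error_le sigma (w : 'cV[R[i]]_#|lib|) l (i : 'I_pmax.+1) p (C : R) :
  (term l).2 = lshift q i ->
  (forall h, h \in supp w -> (mono_degree h <= p)%N) ->
  (forall h, Normc.normc (w h 0) <= C) ->
  Normc.normc (denoise sigma w l 0 - w l 0) <=
  (\sum_(j < pmax.+1 | (i < j <= p)%N) `|heat_coef (- (sigma ^+ 2 / 2)) i j|) * C.
Proof.
move=> li wp wC; rewrite (denoise_monomial _ _ li) (le_trans (normc_sum _ _ _)) //.
(* A nonnegative majorant defined on all pairs: the sum over the library may be enlarged to the full
   product, where it collapses to the row of [l]. *)
pose G (x : 'I_S * 'I_(pmax.+1 + q)) : R :=
  if x.1 == (term l).1 then
    if fintype.split x.2 is inl j then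
      if (i < j <= p)%N then `|heat_coef (- (sigma ^+ 2 / 2)) i j| else 0
    else 0
  else 0.
have G0 x : 0 <= G x.
  by rewrite /G; case: ifP => // _; case: fintype.split => // j; case: ifP.
have C0 : 0 <= C := le_trans (normc_ge0 _) (wC l).
apply: (le_trans (y := \sum_h G (term h) * C)).
  rewrite [leLHS]big_mkcond; apply: ler_sum => h _.
  case: ifP => [hl|_]; last by rewrite mulr_ge0.
  rewrite Normc.normcM; have [->|w0] := eqVneq (w h 0) 0.
    by rewrite Normc.normc0 mulr0 mulr_ge0.
  have [->|b0] := eqVneq (library_mx (inv_moment_block sigma) l h) 0.
    by rewrite Normc.normc0 mul0r mulr_ge0.
  have [j [hl1 hj ij _ ->]] := library_mx_inv_neq0 li hl b0.
  rewrite ler_pM ?normc_ge0 // normc_real /G hl1 eqxx hj (unsplitK (inl j)).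
  have := wp h; rewrite inE w0 /mono_degree hj (unsplitK (inl j)) => /(_ isT) jp.
  by rewrite ij jp.
rewrite -mulr_suml ler_wpM2r // -(big_enum_val G) /=.
apply: (le_trans (y := \sum_x G x)).
  by rewrite [leLHS]big_mkcond; apply: ler_sum => x _; case: ifP.
rewrite -(pair_bigA _ (fun s j => G (s, j))) (bigD1 (term l).1) //=.
rewrite [X in _ + X]big1 ?addr0 => [|s sl]; last first.
  by rewrite big1 // => j _; rewrite /G /= (negbTE sl).
rewrite big_split_ord /= [X in _ + X]big1 ?addr0 => [|r _]; last first.
  by rewrite /G eqxx /= (unsplitK (inr r)).
rewrite [leRHS]big_mkcond ler_sum // => j _.
by rewrite /G eqxx /= (unsplitK (inl j)).
Qed.

End library_matrices.

(** * Extrema over the support and its complement *)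

Section separation.
Context {R : realType}.
Variable m : nat.
Implicit Types (I : {set 'I_m}) (v w : 'cV[R[i]]_m).

(** Positivity of [lambda] is what the maximum needs, as that maximum starts from the default value
    0. *)
Lemma separatesI (A : 'M[R[i]]_m) I w (lambda : R) : 0 < lambda ->
  (forall l, l \in I -> lambda < Normc.normc ((invmx A *m w) l 0)) ->
  (forall l, l \notin I -> Normc.normc ((invmx A *m w) l 0) < lambda) ->
  separates A I w lambda.
Proof.
move=> l0 Ilt Igt; split.
  by apply: lt_bigmin => [|l lI]; rewrite ?ltry // lte_fin Ilt.
by apply: bigmax_lt => [|l]; rewrite lte_fin ?inE //; exact: Igt.
Qed.

(** The member [l] keeps the minimum finite; over the empty set it would be +oo, which [fine] sends
    to 0. *)
Lemma min_abs_fine I v l : l \in I ->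
  (forall h, h \in I -> v h 0 != 0) ->
  0 < fine (min_abs I v) /\
  (forall h, h \in I -> fine (min_abs I v) <= Normc.normc (v h 0)).
Proof.
move=> lI v0.
have min_gt0 : (0 < min_abs I v)%E.
  by apply: lt_bigmin => // h hI; rewrite lte_fin -normc_gt0 v0.
have min_le h : h \in I -> (min_abs I v <= (Normc.normc (v h 0))%:E)%E.
  by move=> hI; exact: (bigmin_le_cond _ (fun j => (Normc.normc (v j 0))%:E) hI).
have min_fin : min_abs I v \is a fin_num.
  by rewrite ge0_fin_numE ?ltW // (le_lt_trans (min_le l lI)) ?ltry.
split=> [|h hI]; first by rewrite -lte_fin fineK.
by rewrite -lee_fin fineK // min_le.
Qed.

Lemma max_abs_fine I v h : h \in I ->
  Normc.normc (v h 0) <= fine (max_abs I v).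
Proof.
move=> hI; have max_ge : ((Normc.normc (v h 0))%:E <= max_abs I v)%E.
  exact: (le_bigmax_cond _ (fun j => (Normc.normc (v j 0))%:E) hI).
rewrite -lee_fin fineK // ge0_fin_numE; last first.
  by rewrite (le_trans _ max_ge) // lee_fin normc_ge0.
by apply: bigmax_lt => // j _; rewrite ltry.
Qed.

End separation.

(** * Existence of a threshold in the two regimes *)

Section thresholds.
Context {R : realType}.
Variables (n S pmax q : nat).
Variables (alpha : 'I_S -> multi_index n) (omega : 'I_q -> R).
Local Notation lib := (library pmax q alpha).
Implicit Types (w : 'cV[R[i]]_#|lib|).
Local Notation denoise sigma w := (invmx (moment_mx pmax alpha omega sigma) *m w).

Lemma denoise_fourier_normc_ge sigma w l r : (term l).2 = rshift pmax.+1 r ->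
  Normc.normc (w l 0) <= Normc.normc (denoise sigma w l 0).
Proof.
move=> lr; rewrite (denoise_fourier _ _ _ lr) Normc.normcM normc_real.
rewrite ger0_norm ?expR_ge0 // ler_peMl ?normc_ge0 // -{1}expR0 ler_expR.
by rewrite -exprMn divr_ge0 ?sqr_ge0.
Qed.

Lemma denoise_fourier_eq0 sigma w l r : (term l).2 = rshift pmax.+1 r ->
  w l 0 = 0 -> denoise sigma w l 0 = 0.
Proof. by move=> lr l0; rewrite (denoise_fourier _ _ _ lr) l0 mulr0. Qed.

Lemma term_shiftP (l : 'I_#|lib|) :
  (exists i, (term l).2 = lshift q i) \/ (exists r, (term l).2 = rshift pmax.+1 r).
Proof.
by have := splitK (term l).2; case: fintype.split => [i|r] /= <-;
  [left; exists i|right; exists r].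
Qed.

Lemma model_degree_ge w h : h \in supp w -> (mono_degree h <= model_degree w)%N.
Proof. exact: (@leq_bigmax_cond _ (mem (supp w)) (fun h => mono_degree h) h). Qed.

(** An off-diagonal contribution needs i < j <= 2 of equal parity, hence i = 0 and j = 2. The row is
    then a constant term, which the library keeps only for the zero multi-index, so the contributing
    term is the undifferentiated u^2. Injectivity of [alpha] makes [mono_coef] a single
    coefficient. *)
Lemma denoise_low_degree sigma w l (i : 'I_pmax.+1) :
  injective alpha -> (model_degree w <= 2)%N -> mono_coef w (mi0 n) 2 = 0 ->
  (term l).2 = lshift q i -> denoise sigma w l 0 = w l 0.
Proof.
move=> alpha_inj w2 u20 li; apply/eqP; rewrite -subr_eq0 (denoise_monomial _ _ _ li).
rewrite big1 // => h hl.
have [->|b0] := eqVneq (library_mx alpha (inv_moment_block pmax omega sigma) l h) 0.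
  by rewrite mul0r.
have [->|w0] := eqVneq (w h 0) 0; first by rewrite mulr0.
have [j [hl1 hj ij odd_ji _]] := library_mx_inv_neq0 li hl b0.
have jdeg : (j <= 2)%N.
  have := model_degree_ge (w := w) (h := h).
  rewrite inE w0 /mono_degree hj (unsplitK (inl j)) => /(_ isT) jp.
  exact: leq_trans jp w2.
have [i0 j2] : i = 0%N :> nat /\ j = 2%N :> nat by lia.
have alpha0 : alpha (term l).1 = mi0 n.
  have := enum_valP l; rewrite -/(term l) inE li (unsplitK (inl i)).
  by rewrite (_ : i = ord0) ?eqxx ?orbF; [move=> /eqP|exact: val_inj].
case/eqP: w0; rewrite -u20 /mono_coef (big_pred1 h) // => k.
rewrite /is_monomial /mi_of /=; apply/andP/eqP => [[/eqP ka]|->]; last first.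
  by rewrite hl1 alpha0 hj (unsplitK (inl j)) j2.
have := splitK (term k).2; case: fintype.split => [t|//] /= tE /eqP t2.
apply: enum_val_inj; rewrite -/(term k) -/(term h).
rewrite [term k]surjective_pairing [term h]surjective_pairing -tE hj hl1.
have -> : (term k).1 = (term l).1 by apply: alpha_inj; rewrite ka alpha0.
by congr (_, lshift _ _); apply: val_inj; rewrite /= t2 j2.
Qed.

Lemma separates_low_degree sigma w :
  injective alpha -> (model_degree w <= 2)%N -> mono_coef w (mi0 n) 2 = 0 ->
  exists lambda, separates (moment_mx pmax alpha omega sigma) (supp w) w lambda.
Proof.
move=> alpha_inj w2 u20.
(* The default 1 keeps [mu] finite and positive even when the support is empty. *)
pose mu : R := \big[Order.min/1]_(l in supp w) Normc.normc (w l 0).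
have mu0 : 0 < mu.
  by apply: lt_bigmin => // l; rewrite inE normc_gt0.
have muw l : l \in supp w -> mu <= Normc.normc (w l 0).
  by move=> lI; exact: (bigmin_le_cond _ (fun j => Normc.normc (w j 0)) lI).
exists (mu / 2); apply: separatesI => [|l lI|l]; first by rewrite divr_gt0.
  apply: (lt_le_trans (y := Normc.normc (w l 0))).
    by apply: lt_le_trans (muw _ lI); lra.
  have [[i li]|[r lr]] := term_shiftP l; last exact: denoise_fourier_normc_ge lr.
  by rewrite (denoise_low_degree _ _ _ _ li).
rewrite inE negbK => /eqP l0.
suff -> : denoise sigma w l 0 = 0 by rewrite Normc.normc0 divr_gt0.
have [[i li]|[r lr]] := term_shiftP l; last exact: denoise_fourier_eq0 lr l0.
by rewrite (denoise_low_degree _ _ _ _ li).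
Qed.

Lemma separates_small_noise sigma w p (mu M : R) :
  0 < mu -> (forall l, l \in supp w -> mu <= Normc.normc (w l 0)) ->
  (forall l, Normc.normc (w l 0) <= M) ->
  (forall l, l \in supp w -> (mono_degree l <= p)%N) ->
  'C(p, 2)%:R * sigma ^+ 2 <= 1 ->
  'C(p, 2)%:R * sigma ^+ 2 * expR 1 * M < mu / 2 ->
  exists lambda, separates (moment_mx pmax alpha omega sigma) (supp w) w lambda.
Proof.
move=> mu0 muw wM wp x1 xM.
have err l i : (term l).2 = lshift q i ->
    Normc.normc (denoise sigma w l 0 - w l 0) < mu / 2.
  move=> li; apply: le_lt_trans xM.
  rewrite (le_trans (denoise_error_le _ _ li wp wM)) // ler_wpM2r ?heat_coef_row_le //.
  exact: le_trans (normc_ge0 _) (wM l).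
exists (mu / 2); apply: separatesI => [|l lI|l]; first by rewrite divr_gt0.
  have [[i li]|[r lr]] := term_shiftP l; last first.
    apply: lt_le_trans (denoise_fourier_normc_ge _ _ lr).
    by apply: lt_le_trans (muw _ lI); lra.
  have := err l i li; have := muw l lI.
  (* Reverse triangle inequality: a coefficient of modulus at least [mu] with error below [mu / 2]
     stays above [mu / 2]. *)
  have := le_normcD (denoise sigma w l 0) (w l 0 - denoise sigma w l 0).
  rewrite addrC subrK -(normcN (w l 0 - _)) opprB; lra.
rewrite inE negbK => /eqP l0.
have [[i li]|[r lr]] := term_shiftP l.
  by have := err l i li; rewrite l0 subr0.
by rewrite (denoise_fourier_eq0 _ lr l0) Normc.normc0 divr_gt0.
Qed.

End thresholds.

(** * The critical noise level *)

Theorem lemma4p2 (R : realType) (d S pmax q K : nat)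
    (Omega : set 'rV[R]_d) (T : R) (u : 'rV[R]_(d + 1) -> R)
    (alpha0 : multi_index (d + 1)) (alpha : 'I_S -> multi_index (d + 1))
    (omega : 'I_q -> R)
    (wstar : 'cV[R[i]]_#|library pmax q alpha|)
    (psi : 'rV[R]_(d + 1) -> R) (pts : 'I_K -> 'rV[R]_(d + 1))
    (D := space_time Omega T)
    (Gstar := noise_free_mx pmax alpha omega D psi u pts)
    (Gbar := fun rho : set (measurableTypeR R) -> \bar R =>
       continuum_mx pmax alpha omega D psi u rho pts)
    (A := moment_mx pmax alpha omega)
    (p := model_degree wstar) (Sstar := supp wstar)
    (coef_u2 := mono_coef wstar (mi0 (d + 1)) 2) :
  open Omega -> 0 < T ->
  injective alpha -> injective omega ->
  weak_solution omega D alpha0 wstar u ->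
  (forall s, class_C (mi_order (alpha s)) psi) -> compact (fsupp psi) ->
  (forall k, fsupp (fun y => psi (pts k - y)) `<=` D) ->
  \rank Gstar = #|library pmax q alpha| ->
  (forall sigma : R, 0 < sigma ->
     Gbar (normal_prob 0 sigma) = Gstar *m A sigma) ->
  ((p <= 2)%N -> coef_u2 = 0 ->
     forall sigma : R, 0 < sigma ->
       exists lambda : R, separates (A sigma) Sstar wstar lambda) /\
  ((3 <= p)%N \/ (p = 2%N /\ coef_u2 <> 0) ->
     exists sigma_c : R,
       [/\ 0 < sigma_c,
           (2 * 'C(p, 2)%:R * expR 1)^-1 *
             (fine (min_abs Sstar wstar) / fine (max_abs Sstar wstar))
           <= sigma_c ^+ 2,
           sigma_c ^+ 2 <= ('C(p, 2)%:R)^-1 &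
           forall sigma : R, 0 < sigma -> sigma < sigma_c ->
             exists lambda : R, separates (A sigma) Sstar wstar lambda]).
Proof.
move=> _ _ alpha_inj _ _ _ _ _ _ _; split=> [p2 u20 sigma _|deg].
  exact: separates_low_degree.
have p2 : (2 <= p)%N by case: deg => [|[->]]//; lia.
(* With empty support the degree [p] would be 0, as a maximum over no terms. *)
have [l lS] : exists l, l \in Sstar.
  apply/set0Pn; apply: contraTneq p2 => S0.
  by rewrite /p /model_degree -/Sstar S0 big_set0.
have w0 h : h \in Sstar -> wstar h 0 != 0 by rewrite inE.
have [mu0 muw] := min_abs_fine lS w0.
set mu := fine (min_abs _ _) in mu0 muw *; set M := fine (max_abs _ _).
have wM h : Normc.normc (wstar h 0) <= M.
  have [/max_abs_fine//|] := boolP (h \in Sstar).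
  rewrite inE negbK => /eqP ->; rewrite Normc.normc0.
  exact: le_trans (normc_ge0 _) (max_abs_fine wstar lS).
have muM : mu <= M := le_trans (muw l lS) (wM l).
have M0 : 0 < M := lt_le_trans mu0 muM.
have C1 : 1 <= 'C(p, 2)%:R :> R by rewrite ler1n bin_gt0.
have C0 := lt_le_trans ltr01 C1.
have e1 : 1 <= expR 1 :> R by rewrite -{1}expR0 ler_expR.
have e0 := expR_gt0 (1 : R).
set C := 'C(p, 2)%:R in C1 C0 *; set e := expR 1 in e1 e0 *.
(* The claimed lower bound itself serves as sigma_c^2; it is the value at which the error bound C
   sigma^2 e M reaches exactly [mu / 2]. *)
set L := (2 * C * e)^-1 * (mu / M).
have L0 : 0 < L by rewrite mulr_gt0 ?invr_gt0 ?divr_gt0 ?mulr_gt0.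
have CL : C * L * e * M = mu / 2 by rewrite /L; field; rewrite !gt_eqF.
(* After clearing denominators this is mu/2 <= M e, which follows from [mu <= M] and [1 <= e]. *)
have LC : L <= C^-1.
  rewrite -(ler_pM2l C0) mulfV ?gt_eqF //.
  rewrite -(ler_pM2r M0) mul1r -(ler_pM2r e0) mulrAC CL.
  by nra.
have sL : Num.sqrt L ^+ 2 = L by rewrite sqr_sqrtr // ltW.
exists (Num.sqrt L); rewrite sL; split=> //; first by rewrite sqrtr_gt0.
move=> sigma s0 sc.
have sigmaL : sigma ^+ 2 < L.
  by rewrite -sL ltr_pXn2r // nnegrE ?sqrtr_ge0 // ltW.
apply: (@separates_small_noise _ _ _ _ _ _ _ _ _ p mu M) => //.
- exact: model_degree_ge.
- rewrite -/C -ler_pdivlMl // mulr1.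
  exact: le_trans (ltW sigmaL) LC.
- by rewrite -/C -/e -CL !ltr_pM2r // ltr_pM2l.
Qed.
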